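(* For every graph $G$, the following assertions are equivalent: (i) $G$ has two disjoint maximum independent sets; (ii) there exists a maximum independent set $S$ of $G$ such that $\alpha(G-S)=\alpha(G)$; (iii) there exists a matching $M$ of $G$ of size $\alpha(G)$ such that the induced subgraph $G[V(M)]$ is a bipartite graph; (iv) $G$ has an induced bipartite subgraph of order $2\alpha(G)$; (v) there exists a set $A\subset V(G)$ such that $G-A$ is a bipartite graph having a perfect matching of size $\alpha(G)$.
   Context: All graphs are finite, undirected, without loops or multiple edges. An independent set is a set of pairwise non-adjacent vertices; $\alpha(G)$ is the maximum size of an independent set of $G$, and a maximum independent set is an independent set of size $\alpha(G)$. For $X\subseteq V(G)$, $G[X]$ is the subgraph induced by $X$ and $G-X=G[V(G)\setminus X]$. A matching is a set of pairwise non-incident edges, $V(M)$ is the set of vertices covered by the matching $M$, and $M$ is perfect if it covers all vertices. The order of a graph is its number of vertices. The set $A$ in (v) may be empty (inclusion is not required to exclude any particular subset of $V(G)$). *)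

(* Defs.v *)
From mathcomp Require Import all_boot.

Set Implicit Arguments.
Unset Strict Implicit.
Unset Printing Implicit Defensive.

Record sgraph := SGraph {
  vertex :> finType;
  adj : rel vertex;
  adj_sym : symmetric adj;
  adj_irrefl : irreflexive adj
}.

Section Graph.
Variable G : sgraph.

Definition independent (S : {set G}) : bool :=
  [forall x in S, forall y in S, ~~ adj x y].

Definition alpha : nat := \max_(S : {set G} | independent S) #|S|.

Definition max_independent (S : {set G}) : bool :=
  independent S && (#|S| == alpha).

(* An edge is the two-element set of its endpoints. *)
Definition edges : {set {set G}} := [set [set x; y] | x in G, y in G & adj x y].

(* V(M) is [cover M]. *)
Definition matching (M : {set {set G}}) : bool :=
  (M \subset edges) && trivIset M.

Definition perfect_matching (M : {set {set G}}) : bool :=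
  matching M && (cover M == [set: G]).

(* Either colour class may be empty. *)
Definition bipartite : bool :=
  [exists A : {set G}, independent A && independent (~: A)].

Section Induced.
Variable X : {set G}.

Definition induced_adj : rel {x : G | x \in X} :=
  fun u v => adj (val u) (val v).

Lemma induced_sym : symmetric induced_adj.
Proof. by move=> u v; apply: adj_sym. Qed.

Lemma induced_irrefl : irreflexive induced_adj.
Proof. by move=> u; apply: adj_irrefl. Qed.

Definition induced : sgraph := SGraph induced_sym induced_irrefl.

End Induced.

Definition delete (X : {set G}) : sgraph := induced (~: X).

End Graph.

(* Main.v *)
Require Import Defs.
From mathcomp Require Import all_boot.

(** If [S] and [T] are disjoint maximum independent sets and [X \subset S] had
    fewer than [#|X|] neighbours in [T], then replacing these neighbours by [X]
    would turn [T] into an independent set larger than [T].  So Hall's condition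
    holds, and [S] is matched perfectly into [T].  Conversely, each colour class
    of an induced bipartite subgraph has at most [alpha G] vertices, so when the
    order is [2 * alpha G] both classes are maximum independent sets. *)

(* Rado's proof: as long as some [N x] has two elements, one of them can be
   removed without destroying Hall's condition, because the size of the
   neighbourhood is submodular; when all [N x] are singletons, [N] is [f]. *)
Lemma hall_injection (T U : finType) (N : T -> {set U}) :
    (forall X : {set T}, #|X| <= #|\bigcup_(x in X) N x|) ->
  exists2 f : T -> U, injective f & forall x, f x \in N x.
Proof.
have [n] := ubnP (\sum_x #|N x|); elim: n => // n IHn in N * => ltNn hall.
have [/existsP[x /card_gt1P[y1 [y2 [Ny1 Ny2 y12]]]]|] :=
  boolP [exists x, 1 < #|N x|]; last first.
  rewrite negb_exists => /forallP small.
  have Nne x : exists y, y \in N x.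
    by apply/card_gt0P; have := hall [set x]; rewrite cards1 big_set1.
  have fN x : xchoose (Nne x) \in N x := xchooseP (Nne x).
  have N1 x : N x = [set xchoose (Nne x)].
    by apply/esym/eqP; rewrite eqEcard sub1set fN cards1 leqNgt small.
  exists (fun x => xchoose (Nne x)) => // x y fxy.
  apply/eqP/negPn/negP => xy; have := hall [set x; y].
  rewrite cards2 xy big_setU1 ?inE //= big_set1 (N1 x) (N1 y) fxy setUid.
  by rewrite cards1.
pose N' (y : U) z := if z == x then N x :\ y else N z.
have N'sub y z : N' y z \subset N z.
  by rewrite /N'; case: eqP => [->|_]; rewrite ?subD1set.
(* Removing an element [y] of [N x] lowers the total size of the sets by one, so the induction
   hypothesis applies as soon as Hall's condition survives. *)
have step y : y \in N x ->
    (forall X : {set T}, #|X| <= #|\bigcup_(z in X) N' y z|) ->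
  exists2 f : T -> U, injective f & forall z, f z \in N z.
  move=> Ny /IHn[]; last first.
    by move=> f f_inj fN; exists f => // z; apply: subsetP (N'sub y z) _ _.
  rewrite -ltnS; apply: leq_trans ltNn; rewrite ltnS.
  rewrite (bigD1 x) //= [leqRHS](bigD1 x) //= -addSn.
  apply: leq_add; last by apply: leq_sum => z _; apply: subset_leq_card.
  by rewrite /N' eqxx (cardsD1 y (N x)) Ny.
pose good y := [forall X : {set T}, #|X| <= #|\bigcup_(z in X) N' y z|].
have [/forallP|] := boolP (good y1); first exact: step.
have [/forallP|] := boolP (good y2); first by move=> h _; apply: step h.
rewrite !negb_forall => /existsP[X2]; rewrite -ltnNge => bad2.
move=> /existsP[X1]; rewrite -ltnNge => bad1.
(* A set violating Hall's condition for [N' y] contains [x], since elsewhere [N' y] agrees with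
   [N]. *)
have badx y (X : {set T}) : #|\bigcup_(z in X) N' y z| < #|X| -> x \in X.
  apply: contraTT => xX; rewrite -leqNgt; apply: leq_trans (hall X) _.
  rewrite (eq_bigr (N' y)) // => z zX.
  by rewrite /N'; case: eqP => // zx; rewrite -zx zX in xX.
have [x1 x2] := (badx _ _ bad1, badx _ _ bad2).
set P := \bigcup_(z in X1) _ in bad1; set Q := \bigcup_(z in X2) _ in bad2.
(* Nothing of [N x] is lost in the union: only [y1] is removed on the side of [P], and it is kept in
   [Q] because [y1] and [y2] differ. *)
have leU : #|X1 :|: X2| <= #|P :|: Q|.
  apply: leq_trans (hall _) (subset_leq_card _).
  apply/bigcupsP => z zX; apply/subsetP => y yN; rewrite inE.
  have [zx|zx] := eqVneq z x.
    have [yy1|yy1] := eqVneq y y1.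
      apply/orP; right; apply/bigcupP; exists x => //.
      by rewrite /N' eqxx !inE yy1 y12 Ny1.
    apply/orP; left; apply/bigcupP; exists x => //.
    by rewrite /N' eqxx !inE yy1 -zx yN.
  by case/setUP: zX => zX; apply/orP; [left|right]; apply/bigcupP; exists z;
     rewrite // /N' (negPf zx).
have leI : #|(X1 :&: X2) :\ x| <= #|P :&: Q|.
  apply: leq_trans (hall _) (subset_leq_card _).
  apply/bigcupsP => z; rewrite !inE => /and3P[zx z1 z2].
  apply/subsetP => y yN; rewrite inE.
  by apply/andP; split; apply/bigcupP; exists z; rewrite // /N' (negPf zx).
(* Hall's condition for [N] gives [#|P| + #|Q| >= #|X1| + #|X2| - 1], the loss of one coming from
   [x]; the two violations give at most [#|X1| + #|X2| - 2]. *)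
have := leq_add leU leI; rewrite cardsUI => le.
have := cardsUI X1 X2; rewrite (cardsD1 x (X1 :&: X2)) inE x1 x2 addnCA add1n.
move=> eX; have := leq_add bad1 bad2; rewrite -eX addSn addnS ltnS.
by rewrite ltnNge le.
Qed.

Lemma independentP (G : sgraph) (S : {set G}) :
  reflect {in S &, forall x y, ~~ adj x y} (independent S).
Proof.
apply: (iffP forall_inP) => [indS x y xS yS|indS x xS].
  exact: (forall_inP (indS x xS)).
by apply/forall_inP => y; apply: indS.
Qed.

Lemma leq_alpha {G : sgraph} {S : {set G}} : independent S -> #|S| <= alpha G.
Proof. exact: leq_bigmax_cond. Qed.

Lemma exists_max_independent (G : sgraph) :
  exists S : {set G}, max_independent S.
Proof.
have ind0 : independent (set0 : {set G}).
  by apply/independentP => x y; rewrite inE.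
have [|S indS eS] :=
    @eq_bigmax_cond _ (@independent G) (fun S : {set G} => #|S|).
  by apply/card_gt0P; exists set0.
by exists S; rewrite /max_independent /alpha eS eqxx andbT.
Qed.

Section InducedSubgraph.
Context {G : sgraph} (X : {set G}).

Lemma card_induced : #|induced X| = #|X|.
Proof. exact: card_sig. Qed.

Lemma card_val_induced (B : {set induced X}) :
  #|[set val x | x in B]| = #|B|.
Proof. exact: card_imset val_inj. Qed.

Lemma val_induced_sub (B : {set induced X}) :
  [set val x | x in B] \subset X.
Proof. by apply/subsetP => _ /imsetP[x _ ->]; apply: valP. Qed.

Lemma val_induced_independent {B : {set induced X}} :
  independent B -> independent [set val x | x in B].
Proof.
move/independentP => indB; apply/independentP.
by move=> _ _ /imsetP[x xB ->] /imsetP[y yB ->]; apply: indB.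
Qed.

Lemma preim_induced_independent {S : {set G}} :
  independent S -> independent [set x : induced X | val x \in S].
Proof.
move/independentP => indS; apply/independentP => x y.
by rewrite !inE; apply: indS.
Qed.

Lemma card_preim_induced (S : {set G}) : S \subset X ->
  #|[set x : induced X | val x \in S]| = #|S|.
Proof.
move=> /subsetP SX; rewrite -card_val_induced; congr #|pred_of_set _|.
apply/setP => x; apply/imsetP/idP => [[y]|xS]; first by rewrite inE => yS ->.
by exists (exist _ x (SX x xS) : induced X); rewrite ?inE.
Qed.

Lemma alpha_induced : alpha (induced X) <= alpha G.
Proof.
apply/bigmax_leqP => B indB; rewrite -card_val_induced.
exact/leq_alpha/val_induced_independent.
Qed.

End InducedSubgraph.

Lemma bipartite_induced_setU (G : sgraph) (S T : {set G}) :
  independent S -> independent T -> bipartite (induced (S :|: T)).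
Proof.
move=> indS indT; apply/existsP.
exists [set x : induced (S :|: T) | val x \in S].
rewrite preim_induced_independent //=.
have /independentP indT' := preim_induced_independent (S :|: T) indT.
apply/independentP => x y; rewrite !inE => xS yS.
(* A vertex of [S :|: T] outside [S] lies in [T]. *)
by apply: indT'; rewrite inE;
  [have := valP x|have := valP y]; rewrite inE ?(negPf xS) ?(negPf yS).
Qed.

Lemma bipartite_order_alpha (G : sgraph) (X : {set G}) :
    bipartite (induced X) -> #|X| = 2 * alpha G ->
  exists B : {set induced X},
    [/\ independent B, independent (~: B), #|B| = alpha G
      & #|~: B| = alpha G].
Proof.
case/existsP=> B /andP[indB indC] cX; exists B.
have leB := leq_trans (leq_alpha indB) (alpha_induced X).
have leC := leq_trans (leq_alpha indC) (alpha_induced X).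
have := cardsC B; rewrite card_induced cX mul2n -addnn => e.
have eB : #|B| = alpha G.
  apply/eqP; rewrite eqn_leq leB -(leq_add2r (alpha G)) -e leq_add2l.
  exact: leC.
by split=> //; apply/eqP; rewrite -(eqn_add2l (alpha G)) -{1}eB e.
Qed.

(** Disjointness turns the size of the cover into a sum over the edges, and each edge contributes
    exactly two because there are no loops. *)
Lemma card_cover_matching {G : sgraph} {M : {set {set G}}} :
  matching M -> #|cover M| = 2 * #|M|.
Proof.
case/andP=> /subsetP Medge /eqP <-; rewrite mulnC -sum_nat_const.
apply: eq_bigr => e /Medge /imset2P[x y _].
rewrite inE => xy ->; rewrite cards2; case: eqP xy => // ->.
by rewrite adj_irrefl andbF.
Qed.

Lemma max_independent_matching {G : sgraph} {S T : {set G}} :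
    max_independent S -> max_independent T -> [disjoint S & T] ->
  exists M : {set {set G}},
    [/\ matching M, #|M| = alpha G & cover M = S :|: T].
Proof.
move=> /andP[/independentP indS /eqP cS] /andP[/independentP indT /eqP cT] dST.
pose N (x : {x | x \in S}) := [set y in T | adj (val x) y].
have [X|f f_inj fN] := hall_injection _ _ N.
  set NX := \bigcup_(x in X) N x.
  have NXT : NX \subset T.
    by apply/bigcupsP => x _; apply/subsetP => y; rewrite inE => /andP[].
  have XS : [set val x | x in X] \subset S.
    by apply/subsetP => _ /imsetP[x _ ->]; apply: valP.
  have noXT x y : x \in [set val x | x in X] -> y \in T :\: NX -> ~~ adj x y.
    case/imsetP=> {}x xX -> /setDP[yT]; apply: contra => xy.
    by apply/bigcupP; exists x; rewrite // inE yT.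
  (* The exchanged set; its size [#|X| + #|T| - #|NX|] is at most [alpha G = #|T|], which is Hall's
     condition for [X]. *)
  have indU : independent ([set val x | x in X] :|: (T :\: NX)).
    apply/independentP => x y /setUP[xX|xT] /setUP[yX|yT].
    - by apply: indS; apply: subsetP XS _ _.
    - exact: noXT.
    - by rewrite adj_sym; apply: noXT.
    - by case/setDP: xT => xT _; case/setDP: yT => yT _; apply: indT.
  have := leq_alpha indU; rewrite cardsU (_ : _ :&: _ = set0); last first.
    apply/eqP; rewrite setI_eq0; apply: disjointWl XS _.
    by apply: disjointWr dST; apply: subsetDl.
  rewrite cards0 subn0 (card_imset _ val_inj) cardsDS // -cT.
  by rewrite addnBA ?subset_leq_card // leq_subLR leq_add2r.
have fT x : f x \in T by have := fN x; rewrite inE => /andP[].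
have adjf x : adj (val x) (f x) by have := fN x; rewrite inE => /andP[].
(* No vertex is both a left and a right endpoint; with [f] injective, this makes the edges distinct
   and pairwise disjoint. *)
have neq (x y : {x | x \in S}) : val x != f y.
  have xS : val x \in S := valP x.
  by apply: contraTneq xS => ->; rewrite (disjointFl dST (fT y)).
pose edge (x : {x | x \in S}) := [set val x; f x].
have edge_inj : injective edge.
  move=> x y exy; have : val x \in edge y by rewrite -exy !inE eqxx.
  by rewrite !inE (negPf (neq x y)) orbF => /eqP/val_inj.
(* Since [S] and [T] have equal size, the injection [f] is onto [T], so the matching covers all of
   [S :|: T]. *)
have fS : [set f x | x : {x | x \in S}] = T.
  apply/eqP; rewrite eqEcard card_imset // card_sig cS cT leqnn andbT.
  by apply/subsetP => _ /imsetP[x _ ->].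
exists [set edge x | x : {x | x \in S}]; split.
- apply/andP; split.
    apply/subsetP => _ /imsetP[x _ ->].
    by apply/imset2P; exists (val x) (f x); rewrite ?inE //= adjf.
  apply/trivIsetP => _ _ /imsetP[x _ ->] /imsetP[y _ ->] exy.
  have xy : x != y by apply: contraNneq exy => ->.
  rewrite -setI_eq0; apply/eqP/setP => z; rewrite !inE; apply/negP.
  case/andP=> /orP[]/eqP -> /orP[].
  - by rewrite val_eqE (negPf xy).
  - by rewrite (negPf (neq _ _)).
  - by rewrite eq_sym (negPf (neq _ _)).
  - by rewrite (inj_eq f_inj) (negPf xy).
- by rewrite card_imset // card_sig.
- apply/setP => z; rewrite cover_imset -fS inE; apply/bigcupP/orP.
    case=> x _; rewrite !inE => /orP[]/eqP ->; first by left; apply: valP.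
    by right; apply: imset_f.
  case=> [zS|/imsetP[x _ ->]].
    by exists (exist _ z zS); rewrite // !inE eqxx.
  by exists x; rewrite // !inE eqxx orbT.
Qed.

Theorem theorem2p1 (G : sgraph) :
  [<-> (* (i) *)
       exists S1 S2 : {set G},
         [/\ max_independent S1, max_independent S2 & [disjoint S1 & S2]];
       (* (ii) *)
       exists S : {set G}, max_independent S /\ alpha (delete S) = alpha G;
       (* (iii) *)
       exists M : {set {set G}},
         [/\ matching M, #|M| = alpha G & bipartite (induced (cover M))];
       (* (iv) *)
       exists X : {set G},
         bipartite (induced X) /\ #|induced X| = 2 * alpha G;
       (* (v) *)
       exists A : {set G},
         bipartite (delete A) /\
         exists M : {set {set delete A}},
           perfect_matching M /\ #|M| = alpha G].
Proof.
tfae.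
- case=> S [T [maxS /andP[indT /eqP cT] dST]]; exists S; split=> //.
  (* [T] avoids [S], so it survives in the graph without [S] and attains the bound there. *)
  apply/eqP; rewrite eqn_leq alpha_induced /= -{1}cT.
  rewrite -(@card_preim_induced _ (~: S)) -?disjoints_subset 1?disjoint_sym //.
  exact/leq_alpha/preim_induced_independent.
- case=> S [maxS eS].
  have [T /andP[indT /eqP cT]] := exists_max_independent (delete S).
  have maxT : max_independent [set val x | x in T].
    by rewrite /max_independent val_induced_independent // card_val_induced
               cT eS /=.
  have dST : [disjoint S & [set val x | x in T]].
    by rewrite disjoint_sym disjoints_subset val_induced_sub.
  have [M [matM cM covM]] := max_independent_matching maxS maxT dST.
  exists M; split=> //; rewrite covM.
  case/andP: maxS maxT => indS _ /andP[indT' _].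
  exact: bipartite_induced_setU.
- case=> M [matM cM bipM]; exists (cover M); split=> //.
  by rewrite card_induced (card_cover_matching matM) cM.
- case=> X [bipX]; rewrite card_induced => cX; exists (~: X).
  rewrite /delete setCK; split=> //.
  have [B [indB indC cB cC]] := bipartite_order_alpha _ _ bipX cX.
  (* This makes both colour classes maximum independent sets of [induced X] itself, so the matching
     is built directly inside that graph, where it covers every vertex. *)
  have eX : alpha (induced X) = alpha G.
    by apply/eqP; rewrite eqn_leq alpha_induced -cB leq_alpha.
  have [||| M [matM cM covM]] := @max_independent_matching (induced X) B (~: B).
  + by rewrite /max_independent indB cB eX /=.
  + by rewrite /max_independent indC cC eX /=.
  + by rewrite disjoints_subset setCK.
  by exists M; rewrite /perfect_matching matM covM setUCr cM /=.
- case=> A [bipA [M [/andP[matM /eqP covM] cM]]].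
  (* The perfect matching serves only to fix the order; the colour classes then give the two
     disjoint maximum independent sets. *)
  have cA : #|~: A| = 2 * alpha G.
    by rewrite -card_induced -cardsT -covM (card_cover_matching matM) cM.
  have [B [indB indC cB cC]] := bipartite_order_alpha _ _ bipA cA.
  exists [set val x | x in B], [set val x | x in ~: B].
  rewrite /max_independent !val_induced_independent // !card_val_induced.
  rewrite cB cC eqxx; split=> //.
  rewrite -setI_eq0 -imsetI ?setICr ?imset0 //.
  by move=> x y _ _; apply: val_inj.
Qed.
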